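(* Let $R$ be a ring, $X$ a topological space and $f:R\rightarrow C(X)$ a ring homomorphism. Then the following hold: (1) If $\mathcal{A}\subseteq \mathrm{Spec}(C(X))$ is compact, then $\mathcal{A}'=\{f^{-1}(P)\mid P\in\mathcal{A}\}$ has the P.A-property for $R$. (2) If $I$ is an ideal of $R$, then $I^e=C(X)$ if and only if $f(I)$ contains a unit of $C(X)$.
   Context: $C(X)$ denotes the ring of all continuous real-valued functions on $X$. All rings are commutative with $1\neq 0$ and ring homomorphisms are unital. For an ideal $I$ of $R$, $I^e=f(I)C(X)$ is the ideal of $C(X)$ generated by $f(I)$. A set $\mathcal{B}\subseteq \mathrm{Spec}(R)$ has the P.A-property (prime avoidance property) for $R$ if whenever an ideal $I$ of $R$ satisfies $I\subseteq\bigcup_{P\in\mathcal{B}}P$, there exists $P\in\mathcal{B}$ with $I\subseteq P$. Subsets of a prime spectrum carry the subspace topology of the Zariski topology; compact means every open cover has a finite subcover (no Hausdorff condition). *)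

(* Defs.v *)
From HB Require Import structures.
From mathcomp Require Import all_boot all_order all_algebra.
From mathcomp Require Import all_classical all_reals all_analysis.

Set Implicit Arguments.
Unset Strict Implicit.
Unset Printing Implicit Defensive.

Import Order.TTheory GRing.Theory Num.Theory.
Import numFieldNormedType.Exports.

Local Open Scope classical_set_scope.
Local Open Scope ring_scope.

(* The ring C(X) is [continuousType X K] for [K : realType], with pointwise
   operations.  It is only a [comPzRingType], because [X] may be empty and then
   C(X) is the zero ring; for nonempty [X] one has 1 != 0 in C(X). *)
Section ContinuousRing.
Variables (X : topologicalType) (K : realType).
Local Notation CX := (continuousType X K).

Lemma cts_add_subproof (u v : CX) : continuous (fun x => u x + v x).
Proof. by move=> x; apply: cvgD; exact: cts_fun. Qed.

Lemma cts_opp_subproof (u : CX) : continuous (fun x => - u x).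
Proof. by move=> x; apply: cvgN; exact: cts_fun. Qed.

Lemma cts_mul_subproof (u v : CX) : continuous (fun x => u x * v x).
Proof. by move=> x; apply: cvgM; exact: cts_fun. Qed.

Lemma cts_cst_subproof (c : K) : continuous (fun _ : X => c).
Proof. by move=> x; exact: cvg_cst. Qed.

Definition cts_zero : CX := mkcts (@cts_cst_subproof 0).
Definition cts_one : CX := mkcts (@cts_cst_subproof 1).
Definition cts_add (u v : CX) : CX := mkcts (@cts_add_subproof u v).
Definition cts_opp (u : CX) : CX := mkcts (@cts_opp_subproof u).
Definition cts_mul (u v : CX) : CX := mkcts (@cts_mul_subproof u v).

Lemma cts_addA : associative cts_add.
Proof. by move=> u v w; apply/continuousEP => x; exact: addrA. Qed.

Lemma cts_addC : commutative cts_add.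
Proof. by move=> u v; apply/continuousEP => x; exact: addrC. Qed.

Lemma cts_add0 : left_id cts_zero cts_add.
Proof. by move=> u; apply/continuousEP => x; exact: add0r. Qed.

Lemma cts_addN : left_inverse cts_zero cts_opp cts_add.
Proof. by move=> u; apply/continuousEP => x; exact: addNr. Qed.

HB.instance Definition _ := GRing.isZmodule.Build CX
  cts_addA cts_addC cts_add0 cts_addN.

Lemma cts_mulA : associative cts_mul.
Proof. by move=> u v w; apply/continuousEP => x; exact: mulrA. Qed.

Lemma cts_mulC : commutative cts_mul.
Proof. by move=> u v; apply/continuousEP => x; exact: mulrC. Qed.

Lemma cts_mul1 : left_id cts_one cts_mul.
Proof. by move=> u; apply/continuousEP => x; exact: mul1r. Qed.

Lemma cts_mulDl : left_distributive cts_mul cts_add.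
Proof. by move=> u v w; apply/continuousEP => x; exact: mulrDl. Qed.

HB.instance Definition _ := GRing.Zmodule_isComPzRing.Build CX
  cts_mulA cts_mulC cts_mul1 cts_mulDl.

Lemma cts0E (x : X) : (0 : CX) x = 0. Proof. by []. Qed.
Lemma cts1E (x : X) : (1 : CX) x = 1. Proof. by []. Qed.
Lemma ctsDE (u v : CX) (x : X) : (u + v) x = u x + v x. Proof. by []. Qed.
Lemma ctsNE (u : CX) (x : X) : (- u) x = - u x. Proof. by []. Qed.
Lemma ctsME (u v : CX) (x : X) : (u * v) x = u x * v x. Proof. by []. Qed.

End ContinuousRing.

(* The ideals of [ring_quotient] are proper, boolean-valued and restricted to
   rings with 1 != 0.  Here ideals are sets and the unit ideal is allowed. *)
Definition is_ideal (A : comPzRingType) (I : set A) : Prop :=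
  [/\ I 0, forall a b, I a -> I b -> I (a + b)
         & forall c a, I a -> I (c * a)].

Definition is_prime_ideal (A : comPzRingType) (P : set A) : Prop :=
  [/\ is_ideal P, ~ P 1 & forall a b, P (a * b) -> P a \/ P b].

(* [GRing.unit] is not available on a [comPzRingType]. *)
Definition is_unit (A : comPzRingType) (u : A) : Prop := exists v, u * v = 1.

Record Spec (A : comPzRingType) := MkSpec {
  spec_ideal :> set A;
  spec_prime : is_prime_ideal spec_ideal
}.

HB.instance Definition _ (A : comPzRingType) := gen_eqMixin (Spec A).
HB.instance Definition _ (A : comPzRingType) := gen_choiceMixin (Spec A).

Definition zariski_V (A : comPzRingType) (E : set A) : set (Spec A) :=
  [set P : Spec A | E `<=` P].

Definition zariski_open (A : comPzRingType) (U : set (Spec A)) : Prop :=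
  exists E : set A, U = ~` zariski_V E.

Section ZariskiTopology.
Variable A : comPzRingType.

Lemma zariski_openT : @zariski_open A setT.
Proof.
exists setT; apply/seteqP; split=> // -[P pP] _ /= /(_ 1 I).
by case: pP.
Qed.

Lemma zariski_openI : setI_closed (@zariski_open A).
Proof.
move=> _ _ [E ->] [F ->]; exists [set z | exists2 x, E x & exists2 y, F y & z = x * y].
apply/seteqP; split=> -[P pP] /=; rewrite /zariski_V /=.
  case=> /existsNP[x /not_implyP[Ex nPx]] /existsNP[y /not_implyP[Fy nPy]] sub.
  have := sub (x * y); case: (pP) => _ _ PM H.
  have /PM [] // : P (x * y) by apply: H; exists x => //; exists y.
case: (pP) => -[_ _ PM] _ _ nsub; split=> sub; apply: nsub => z [x Ex [y Fy ->]].
  by rewrite mulrC; apply: PM; exact: sub.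
by apply: PM; exact: sub.
Qed.

Lemma zariski_open_bigU (I : Type) (U : I -> set (Spec A)) :
  (forall i, zariski_open (U i)) -> zariski_open (\bigcup_i U i).
Proof.
move=> /choice[E UE]; exists (\bigcup_i E i); apply/seteqP; split=> P.
  by case=> i _; rewrite UE /= => nsub sub; apply: nsub => x Ex; apply: sub; exists i.
move=> nsub; apply: contrapT => nU; apply: nsub => x [i _ Eix].
apply: contrapT => nPx; apply: nU; exists i => //; rewrite UE => sub.
by apply: nPx; exact: sub.
Qed.

HB.instance Definition _ := isOpenTopological.Build (Spec A)
  zariski_openT zariski_openI zariski_open_bigU.

Lemma zariski_openE : @open (Spec A) = @zariski_open A.
Proof. by []. Qed.

End ZariskiTopology.

Section Contraction.
Variables (A B : comPzRingType) (f : {rmorphism A -> B}).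

Lemma prime_ideal_preimage (P : Spec B) : is_prime_ideal (f @^-1` P).
Proof.
case: P => P [[P0 PD PM] P1 PP] /=; split; rewrite /preimage /mkset.
- split=> [|a b|c a] /=.
  + by rewrite rmorph0.
  + by rewrite rmorphD; exact: PD.
  + by rewrite rmorphM; exact: PM.
- by rewrite rmorph1.
- by move=> a b; rewrite rmorphM; exact: PP.
Qed.

Definition spec_preimage (P : Spec B) : Spec A :=
  MkSpec (prime_ideal_preimage P).

Definition ideal_ext (I : set A) : set B := smallest (@is_ideal B) (f @` I).

End Contraction.

Definition PA_property (A : comPzRingType) (B : set (Spec A)) : Prop :=
  forall I : set A, is_ideal I ->
    I `<=` \bigcup_(P in B) (P : set A) ->
    exists2 P : Spec A, B P & I `<=` P.

(* Main.v *)
Require Import Defs.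
From mathcomp Require Import all_boot all_order all_algebra.
From mathcomp Require Import all_classical all_reals all_analysis.

Import Order.TTheory GRing.Theory Num.Theory.
Import numFieldNormedType.Exports.

Local Open Scope classical_set_scope.
Local Open Scope ring_scope.

(** Both parts rest on sums of squares.  Given finitely many elements [a_i] of
    an ideal [I] of [R], the element [b], the sum of the [a_i ^+ 2], is again
    in [I], and [f b] dominates every [(f a_i) ^+ 2] pointwise
    ([ideal_sum_squares]).

    Part (1): prime ideals of C(X) are absolutely convex
    ([prime_ideal_abs_convex]), so a prime containing [f b] contains every
    [f a_i].  If no prime in the compact set [A] contains [f(I)], the basic
    open sets [f a \notin P], for [a] in [I], cover [A]; for the [a_i] of a
    finite subcover, [f b] then lies outside every prime in [A], which
    contradicts the assumption that [I] is covered by the contracted primes.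

    Part (2): the functions that vanish wherever [f b] does, for some [b] in
    [I] depending on the function, form an ideal containing [f(I)]; closure
    under addition is again the sum of squares.  If the extension of [I] is
    everything, [1] is such a function, so some [f b] vanishes nowhere, and
    hence is a unit. *)

(** The quotient [u ^+ 2 / v] is squeezed by [u] at the zeros of [v], where
    division by zero already gives it the value [0].  A first power of [u] in
    the numerator would only give a bounded function there. *)
Lemma continuous_sqr_div {X : topologicalType} {K : realType}
    (u v : continuousType X K) :
  (forall x, `|u x| <= `|v x|) -> continuous (fun x => u x ^+ 2 / v x).
Proof.
move=> uv x; have [vx0|vx0] := eqVneq (v x) 0; last first.
  by apply: cvgM; [rewrite expr2; apply: cvgM; exact: cts_fun
                  |apply: cvgV => //; exact: cts_fun].
have ux0 : u x = 0.
  by apply/eqP; rewrite -normr_le0 (le_trans (uv x))// vx0 normr0.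
rewrite /continuous_at vx0 invr0 mulr0.
have u_to0 : u y @[y --> x] --> (0 : K) by rewrite -ux0; exact: cts_fun.
apply: norm_cvg0; apply: (@squeeze_cvgr _ _ _ _ (cst 0) (fun y => `|u y|)).
- apply: nearW => y; rewrite normr_ge0 /= normrM normfV normrX.
  have [vy0|vy0] := eqVneq (v y) 0; first by rewrite vy0 normr0 invr0 mulr0.
  by rewrite ler_pdivrMr ?normr_gt0// expr2 ler_wpM2l.
- exact: cvg_cst.
- by rewrite -(normr0 K); exact: cvg_norm.
Qed.

(** Divisibility is the reason: when [|u| <= |v|], [v] divides [u ^+ 2] in
    C(X), although it need not divide [u]. *)
Lemma prime_ideal_abs_convex {X : topologicalType} {K : realType}
    (P : Spec (continuousType X K)) (u v : continuousType X K) :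
  (forall x, `|u x| <= `|v x|) -> spec_ideal P v -> spec_ideal P u.
Proof.
move=> uv Pv; have [[_ _ PM] _ Pprime] := spec_prime P.
suff : spec_ideal P (u * u) by move=> /Pprime[].
pose k : continuousType X K := mkcts (continuous_sqr_div u v uv).
have -> : u * u = k * v; last exact: PM.
apply/continuousEP => x; rewrite !ctsME /= -expr2.
have [vx0|vx0] := eqVneq (v x) 0; last by rewrite divfK.
have /eqP -> : u x == 0 by rewrite -normr_le0 (le_trans (uv x))// vx0 normr0.
by rewrite vx0 mulr0 expr0n.
Qed.

Lemma nonvanishing_is_unit {X : topologicalType} {K : realType}
    (u : continuousType X K) : (forall x, u x != 0) -> is_unit u.
Proof.
move=> u0; have cV : continuous (fun x => (u x)^-1).
  by move=> x; apply: cvgV => //; exact: cts_fun.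
by exists (mkcts cV : continuousType X K); apply/continuousEP => x; rewrite ctsME /= divff.
Qed.

(** The nonnegativity of [f b] lets one more square be added without losing
    the bounds already obtained. *)
Lemma ideal_sum_squares {X : topologicalType} {K : realType}
    {R : comPzRingType} (f : {rmorphism R -> continuousType X K})
    (I : set R) (s : seq R) :
  is_ideal I -> (forall a, a \in s -> I a) ->
  exists b, [/\ I b, forall x, 0 <= f b x
             & forall a x, a \in s -> f a x ^+ 2 <= f b x].
Proof.
move=> [I0 ID IM]; elim: s => [_|a s IHs sI].
  by exists 0; split=> // x; rewrite rmorph0.
have [|b [Ib b0 sb]] := IHs; first by move=> c cs; apply: sI; rewrite inE cs orbT.
have fE x : f (a * a + b) x = f a x ^+ 2 + f b x.
  by rewrite rmorphD rmorphM ctsDE ctsME expr2.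
exists (a * a + b); split=> [|x|c x].
- by apply: ID => //; apply/IM/sI; rewrite mem_head.
- by rewrite fE addr_ge0 ?sqr_ge0.
- rewrite fE inE => /predU1P[->|cs]; first by rewrite lerDl.
  by rewrite (le_trans (sb _ _ cs))// lerDr sqr_ge0.
Qed.

Lemma compact_contraction_PA {X : topologicalType} {K : realType}
    {R : comPzRingType} (f : {rmorphism R -> continuousType X K})
    (A : set (Spec (continuousType X K))) :
  cover_compact A -> PA_property (spec_preimage f @` A).
Proof.
move=> cA I idI Isub; apply: contrapT => nex.
pose U (a : R) : set (Spec (continuousType X K)) := ~` zariski_V [set f a].
have Uopen a : I a -> open (U a).
  by move=> _; rewrite zariski_openE; exists [set f a].
have Ucover : A `<=` cover I U.
  move=> P AP; apply: contrapT => nPU; apply: nex.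
  exists (spec_preimage f P); first by exists P.
  move=> a Ia; apply: contrapT => nPa; apply: nPU; exists a => // PV.
  by apply: nPa; exact: PV.
have [D DI AD] := cA R I U Uopen Ucover.
have [|b [Ib b0 Db]] := ideal_sum_squares f I (finmap.enum_fset D) idI.
  by move=> a /DI; rewrite inE.
have [_ [P AP <-] /= Pfb] := Isub b Ib.
have [a /= aD] := AD P AP; apply=> _ -> /=.
have [_ _ Pprime] := spec_prime P.
suff : spec_ideal P (f a * f a) by move=> /Pprime[].
apply: (prime_ideal_abs_convex P _ _ _ Pfb) => x.
by rewrite ctsME -expr2 !ger0_norm ?sqr_ge0 ?Db.
Qed.

Lemma ideal_ext_full {X : topologicalType} {K : realType}
    {R : comPzRingType} (f : {rmorphism R -> continuousType X K})
    (I : set R) : is_ideal I ->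
  (ideal_ext f I = setT <-> exists2 u, (f @` I) u & is_unit u).
Proof.
move=> idI; split=> [IeT|[u fIu [v uv1]]].
  pose J : set (continuousType X K) :=
    [set h | exists2 b, I b & forall x, f b x = 0 -> h x = 0].
  have idJ : is_ideal J.
    split=> [|g h [a Ia ag] [b Ib bh]|c h [b Ib bh]].
    - by exists 0 => //; case: idI.
    - have [|d [Id _ abd]] := ideal_sum_squares f I [:: a; b] idI.
        by move=> e; rewrite !inE => /orP[]/eqP->.
      exists d => // x dx0.
      have z e : e \in [:: a; b] -> f e x = 0.
        move=> eab; apply/eqP; rewrite -sqrf_eq0 eq_le sqr_ge0 andbT -dx0.
        exact: abd.
      by rewrite ctsDE ag ?bh ?addr0// z// !inE eqxx ?orbT.
    - by exists b => // x bx0; rewrite ctsME bh ?mulr0.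
  have [b Ib b1] : J 1.
    have : ideal_ext f I 1 by rewrite IeT.
    by apply; split=> // _ [b Ib <-]; exists b.
  exists (f b); first by exists b.
  apply: nonvanishing_is_unit => x; apply/eqP => /b1.
  by apply/eqP; rewrite cts1E oner_neq0.
apply/seteqP; split=> // w _ J [[_ _ JM] fIJ].
by rewrite -[w]mulr1 -uv1 mulrCA mulrC; apply/JM/fIJ.
Qed.

Theorem corollary2p18 (K : realType) (R : comNzRingType) (X : topologicalType)
    (f : {rmorphism R -> continuousType X K}) :
  (forall A : set (Spec (continuousType X K)),
      cover_compact A -> PA_property (spec_preimage f @` A))
  /\
  (forall I : set R, is_ideal I ->
      (ideal_ext f I = setT <-> exists2 u, (f @` I) u & is_unit u)).
Proof.
split; first exact: compact_contraction_PA.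
exact: ideal_ext_full.
Qed.
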